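(* Let $p,q\in E$ and let $M_p$ and $M_{p,q}$ be the associated point and line modules for $Q$. Then, for each $i\in\{1,2,3\}$, there are isomorphisms of graded $Q$-modules $\gamma_i^*M_p\cong M_{p+\xi_i}$ and $\gamma_i^*M_{p,q}\cong M_{p+\xi_i,\,q+\xi_i}$.
   Context: Let $k$ be an algebraically closed field of characteristic not $2$, and let $\alpha_1=\alpha,\alpha_2=\beta,\alpha_3=\gamma\in k$ satisfy $\alpha+\beta+\gamma+\alpha\beta\gamma=0$ and $\{\alpha,\beta,\gamma\}\cap\{0,1,-1\}=\varnothing$. Let $Q$ be the quotient of the free algebra $k\langle x_0,x_1,x_2,x_3\rangle$ (graded, $\deg x_j=1$) by the six relations $x_0x_i-x_ix_0=\alpha_i(x_jx_k+x_kx_j)$, $x_0x_i+x_ix_0=x_jx_k-x_kx_j$, $(i,j,k)$ running over the cyclic permutations of $(1,2,3)$. Regard $x_0,\dots,x_3$ as homogeneous coordinates on $\mathbb P^3=\mathbb P(Q_1^* )$, and let $E\subset\mathbb P^3$ be the elliptic curve $x_0^2+x_1^2+x_2^2+x_3^2=(1-\gamma)x_1^2+(1+\alpha\gamma)x_2^2+(1+\alpha)x_3^2=0$. The group $\Gamma=\{1,\gamma_1,\gamma_2,\gamma_3=\gamma_1\gamma_2\}\cong\mathbb Z/2\times\mathbb Z/2$ acts on $Q$ by graded algebra automorphisms: $\gamma_i$ fixes $x_0,x_i$ and negates $x_j$ for $j\in\{1,2,3\}\setminus\{i\}$. The induced action on $\mathbb P(Q_1^* )$ is by the same sign changes of coordinates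 and preserves $E$. $E$ is given an algebraic group law such that each $\gamma_i$ acts on $E$ as translation by a 2-torsion point, denoted $\xi_i$; thus $E[2]=\{o,\xi_1,\xi_2,\xi_3\}$. For $p\in E$, $M_p=Q/Qp^\perp$, where $p^\perp\subset Q_1$ is the subspace of linear forms vanishing at $p$. For $p,q\in E$, $M_{p,q}=Q/(Qx+Qx')$, where $x=x'=0$ is the line in $\mathbb P(Q_1^* )$ whose scheme-theoretic intersection with $E$ is the divisor $(p)+(q)$. For a graded left $Q$-module $M$ and $\gamma\in\Gamma$, $\gamma^*M$ is $M$ as a graded vector space with new action $r\cdot_\gamma m=\gamma^{-1}(r)m$. *)

(* Defs.v *)
From HB Require Import structures.
From mathcomp Require Import all_boot all_order all_algebra all_fingroup.
From mathcomp Require Import boolp.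
From mathcomp Require Import finmap.
From mathcomp Require Import monalg mpoly.

Set Implicit Arguments.
Unset Strict Implicit.
Unset Printing Implicit Defensive.

Import GRing.Theory.
(* monalg and mpoly both define this notation, with different meanings. *)
Local Notation "{ 'mpoly' R [ n ] }" := (mpoly n R) : type_scope.

Local Open Scope ring_scope.
Local Open Scope quotient_scope.

Section Ideals.
Variables (R : pzRingType) (S : R -> Prop).

Inductive left_ideal : R -> Prop :=
  | left_ideal0 : left_ideal 0
  | left_idealD x y : left_ideal x -> left_ideal y -> left_ideal (x + y)
  | left_idealM a s : S s -> left_ideal (a * s).

Inductive two_sided_ideal : R -> Prop :=
  | two_sided_ideal0 : two_sided_ideal 0
  | two_sided_idealD x y :
      two_sided_ideal x -> two_sided_ideal y -> two_sided_ideal (x + y)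
  | two_sided_idealM a s b : S s -> two_sided_ideal (a * s * b).

Lemma left_ideal_mull a x : left_ideal x -> left_ideal (a * x).
Proof.
elim=> [|y z _ hy _ hz|b s hs]; first by rewrite mulr0; constructor.
  by rewrite mulrDr; constructor.
by rewrite mulrA; constructor.
Qed.

Lemma two_sided_ideal_mull a x : two_sided_ideal x -> two_sided_ideal (a * x).
Proof.
elim=> [|y z _ hy _ hz|b s c hs]; first by rewrite mulr0; constructor.
  by rewrite mulrDr; constructor.
by rewrite !mulrA; constructor.
Qed.

Lemma two_sided_ideal_mulr a x : two_sided_ideal x -> two_sided_ideal (x * a).
Proof.
elim=> [|y z _ hy _ hz|b s c hs]; first by rewrite mul0r; constructor.
  by rewrite mulrDl; constructor.
by rewrite -mulrA; constructor.
Qed.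

Definition left_idealb (x : R) : bool := `[< left_ideal x >].
Definition two_sided_idealb (x : R) : bool := `[< two_sided_ideal x >].

Lemma left_idealb_zmod : zmod_closed left_idealb.
Proof.
split=> [|x y /asboolP hx /asboolP hy]; apply/asboolP; first by constructor.
by rewrite -mulN1r; constructor=> //; apply: left_ideal_mull.
Qed.

Lemma two_sided_idealb_zmod : zmod_closed two_sided_idealb.
Proof.
split=> [|x y /asboolP hx /asboolP hy]; apply/asboolP; first by constructor.
by rewrite -mulN1r; constructor=> //; apply: two_sided_ideal_mull.
Qed.

HB.instance Definition _ := GRing.isZmodClosed.Build R left_idealb
  left_idealb_zmod.
HB.instance Definition _ := GRing.isZmodClosed.Build R two_sided_idealb
  two_sided_idealb_zmod.

Local Notation left_closed := (GRing.ZmodClosed.clone R left_idealb _).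
Local Notation left_zquot := (Quotient.quot left_closed).
Local Notation ring_closed := (GRing.ZmodClosed.clone R two_sided_idealb _).
Local Notation ring_zquot := (Quotient.quot ring_closed).
Definition left_quot : Type := left_zquot.
Definition ring_quot : Type := ring_zquot.

HB.instance Definition _ := GRing.Zmodule.on left_quot.
HB.instance Definition _ := GRing.Zmodule.on ring_quot.

Definition left_pi : R -> left_quot := \pi_left_zquot.
Definition ring_pi : R -> ring_quot := \pi_ring_zquot.

Fact left_pi_zmod : zmod_morphism left_pi.
Proof. exact: (raddfB (\pi_left_zquot)). Qed.
HB.instance Definition _ := GRing.isZmodMorphism.Build R left_quot left_pi
  left_pi_zmod.

Fact ring_pi_zmod : zmod_morphism ring_pi.
Proof. exact: (raddfB (\pi_ring_zquot)). Qed.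
HB.instance Definition _ := GRing.isZmodMorphism.Build R ring_quot ring_pi
  ring_pi_zmod.

Definition left_repr (x : left_quot) : R := generic_quotient.repr (x : left_zquot).
Definition ring_repr (x : ring_quot) : R := generic_quotient.repr (x : ring_zquot).

Lemma left_reprK x : left_pi (left_repr x) = x.
Proof. exact: (reprK (x : left_zquot)). Qed.
Lemma ring_reprK x : ring_pi (ring_repr x) = x.
Proof. exact: (reprK (x : ring_zquot)). Qed.

Lemma left_piP x y : left_pi x = left_pi y <-> left_ideal (x - y).
Proof.
have := Quotient.idealrBE left_closed x y.
rewrite unfold_in /left_idealb => h.
by split=> [/eqP e|/asboolP]; [apply/asboolP; rewrite h|rewrite h => /eqP].
Qed.

Lemma ring_piP x y : ring_pi x = ring_pi y <-> two_sided_ideal (x - y).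
Proof.
have := Quotient.idealrBE ring_closed x y.
rewrite unfold_in /two_sided_idealb => h.
by split=> [/eqP e|/asboolP]; [apply/asboolP; rewrite h|rewrite h => /eqP].
Qed.

Definition left_scale (a : R) (x : left_quot) : left_quot :=
  left_pi (a * left_repr x).

Lemma left_scaleE a x : left_scale a (left_pi x) = left_pi (a * x).
Proof.
apply/left_piP; rewrite -mulrBr; apply: left_ideal_mull.
by apply/left_piP; rewrite left_reprK.
Qed.

Fact left_scaleA a b x : left_scale a (left_scale b x) = left_scale (a * b) x.
Proof. by rewrite -[x]left_reprK !left_scaleE mulrA. Qed.
Fact left_scale1 : left_id 1 left_scale.
Proof. by move=> x; rewrite -[x]left_reprK left_scaleE mul1r. Qed.
Fact left_scaleDr : right_distributive left_scale +%R.
Proof.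
move=> a x y; rewrite -[x]left_reprK -[y]left_reprK.
by rewrite -raddfD !left_scaleE mulrDr raddfD.
Qed.
Fact left_scaleDl x : {morph left_scale^~ x : a b / a + b}.
Proof. by move=> a b; rewrite -[x]left_reprK !left_scaleE mulrDl raddfD. Qed.

HB.instance Definition _ := GRing.Zmodule_isLmodule.Build R left_quot
  left_scaleA left_scale1 left_scaleDr left_scaleDl.

Lemma left_piZ a x : left_pi (a * x) = a *: left_pi x.
Proof. by rewrite -[RHS]/(left_scale _ _) left_scaleE. Qed.

Definition ring_one : ring_quot := ring_pi 1.
Definition ring_mul (x y : ring_quot) : ring_quot :=
  ring_pi (ring_repr x * ring_repr y).

Lemma ring_mulE x y : ring_mul (ring_pi x) (ring_pi y) = ring_pi (x * y).
Proof.
set x' := ring_repr (ring_pi x); set y' := ring_repr (ring_pi y).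
have hx : two_sided_ideal (x' - x) by apply/ring_piP; rewrite ring_reprK.
have hy : two_sided_ideal (y' - y) by apply/ring_piP; rewrite ring_reprK.
apply/ring_piP.
have -> : x' * y' - x * y = x' * (y' - y) + (x' - x) * y.
  by rewrite mulrBr mulrBl addrA subrK.
constructor; first exact: two_sided_ideal_mull.
exact: two_sided_ideal_mulr.
Qed.

Fact ring_mulA : associative ring_mul.
Proof.
move=> x y z; rewrite -[x]ring_reprK -[y]ring_reprK -[z]ring_reprK.
by rewrite !ring_mulE mulrA.
Qed.
Fact ring_mul1 : left_id ring_one ring_mul.
Proof. by move=> x; rewrite -[x]ring_reprK ring_mulE mul1r. Qed.
Fact ring_mulr1 : right_id ring_one ring_mul.
Proof. by move=> x; rewrite -[x]ring_reprK ring_mulE mulr1. Qed.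
Fact ring_mulDl : left_distributive ring_mul +%R.
Proof.
move=> x y z; rewrite -[x]ring_reprK -[y]ring_reprK -[z]ring_reprK.
by rewrite -raddfD !ring_mulE mulrDl raddfD.
Qed.
Fact ring_mulDr : right_distributive ring_mul +%R.
Proof.
move=> x y z; rewrite -[x]ring_reprK -[y]ring_reprK -[z]ring_reprK.
by rewrite -raddfD !ring_mulE mulrDr raddfD.
Qed.

HB.instance Definition _ := GRing.Zmodule_isPzRing.Build ring_quot
  ring_mulA ring_mul1 ring_mulr1 ring_mulDl ring_mulDr.

Fact ring_pi_monoid : monoid_morphism ring_pi.
Proof.
by split=> [|x y]; rewrite // -[RHS]/(ring_mul _ _) ring_mulE.
Qed.
HB.instance Definition _ := GRing.isMonoidMorphism.Build R ring_quot ring_pi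
  ring_pi_monoid.

End Ideals.

(* V is the direct sum of the subgroups P n, n : int. *)
Record is_grading (V : zmodType) (P : int -> V -> Prop) : Prop := IsGrading {
  grading0 : forall n, P n 0;
  gradingB : forall n x y, P n x -> P n y -> P n (x - y);
  grading_sum : forall x, exists (s : seq int) (f : int -> V),
    (forall n, P n (f n)) /\ x = \sum_(n <- s) f n;
  grading_direct : forall (s : seq int) (f : int -> V), uniq s ->
    (forall n, P n (f n)) -> \sum_(n <- s) f n = 0 ->
    forall n, n \in s -> f n = 0 }.

Record is_graded_ring (R : pzRingType) (P : int -> R -> Prop) : Prop :=
  IsGradedRing {
  graded_ring_grading : is_grading P;
  graded_ring1 : P 0 1;
  graded_ringM : forall m n x y, P m x -> P n y -> P (m + n) (x * y) }.

Record graded_module (R : pzRingType) (P : int -> R -> Prop) := GradedModule {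
  gm_sort :> lmodType R;
  gm_deg : int -> gm_sort -> Prop;
  gm_grading : is_grading gm_deg;
  gm_scale : forall m n a x, P m a -> gm_deg n x -> gm_deg (m + n) (a *: x) }.

Definition graded_iso (R : pzRingType) (P : int -> R -> Prop)
    (M N : graded_module P) : Prop :=
  exists f : {linear M -> N},
    bijective f /\ forall n x, gm_deg n x <-> gm_deg n (f x).

Definition homogeneous (V : zmodType) (P : int -> V -> Prop) (x : V) : Prop :=
  exists n, P n x.

Section GradedQuotients.

Lemma gradingD (V : zmodType) (P : int -> V -> Prop) n x y :
  is_grading P -> P n x -> P n y -> P n (x + y).
Proof.
move=> g hx hy; rewrite -[y]opprK; apply: (gradingB g) => //.
by rewrite -sub0r; apply: (gradingB g) => //; apply: (grading0 g).
Qed.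

(* Elements whose homogeneous components lie in N. *)
Definition comps_in (V : zmodType) (P : int -> V -> Prop) (N : V -> Prop) x :=
  exists (s : seq int) (f : int -> V),
    [/\ uniq s, forall n, P n (f n), forall n, N (f n), 
        forall n, n \notin s -> f n = 0 & x = \sum_(n <- s) f n].

Lemma comps_in0 (V : zmodType) (P : int -> V -> Prop) (N : V -> Prop) :
  is_grading P -> N 0 -> comps_in P N 0.
Proof.
move=> g N0; exists [::], (fun=> 0); split=> //; last by rewrite big_nil.
by move=> n; apply: grading0.
Qed.

Lemma sum_supp (V : zmodType) (f : int -> V) (s t : seq int) :
  uniq s -> uniq t -> {subset s <= t} ->
  (forall n, n \notin s -> f n = 0) -> \sum_(n <- s) f n = \sum_(n <- t) f n.
Proof.
move=> us ut st f0; rewrite [RHS](bigID (mem s)) /= [X in _ + X]big1; last first.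
  by move=> n /f0.
rewrite addr0 -[RHS]big_filter; apply: perm_big; apply: uniq_perm => //.
  exact: filter_uniq.
move=> n; rewrite mem_filter /=; case hn: (n \in s) => //=.
by rewrite (st _ hn).
Qed.

Lemma comps_inD (V : zmodType) (P : int -> V -> Prop) (N : V -> Prop) x y :
  is_grading P -> (forall x y, N x -> N y -> N (x + y)) ->
  comps_in P N x -> comps_in P N y -> comps_in P N (x + y).
Proof.
move=> g ND [s [f [us fP fN fs ->]]] [t [h [ut hP hN ht ->]]].
exists (undup (s ++ t)), (fun n => f n + h n); split=> [|n|n|n|].
- exact: undup_uniq.
- exact: gradingD.
- exact: ND.
- by rewrite mem_undup mem_cat => /norP [/fs -> /ht ->]; rewrite addr0.
have u := undup_uniq (s ++ t).
rewrite big_split /=; congr (_ + _); apply: sum_supp => // n hn;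
  by rewrite mem_undup mem_cat hn ?orbT.
Qed.

Lemma comps_in1 (V : zmodType) (P : int -> V -> Prop) (N : V -> Prop) n x :
  is_grading P -> N 0 -> N x -> P n x -> comps_in P N x.
Proof.
move=> g N0 Nx Px; exists [:: n], (fun m => if m == n then x else 0).
split=> // [m|m|m|]; rewrite ?big_seq1 ?eqxx //.
- by case: eqP => [->|] //; have := grading0 g m.
- by case: eqP.
- by rewrite inE; case: eqP.
Qed.

Lemma grading_ind (V : zmodType) (P : int -> V -> Prop) (T : V -> Prop) :
  is_grading P -> T 0 -> (forall x y, T x -> T y -> T (x + y)) ->
  (forall n x, P n x -> T x) -> forall x, T x.
Proof.
move=> g T0 TD T1 x; have [s [f [fP ->]]] := grading_sum g x.
by elim/big_ind: _ => // n _; apply: T1 (fP n).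
Qed.

(* A grading passes to the quotient by a subgroup N which is spanned by its
   homogeneous elements. *)
Lemma quot_grading (V W : zmodType) (P : int -> V -> Prop) (N : V -> Prop)
    (p : {additive V -> W}) :
  is_grading P -> (forall y, exists x, y = p x) ->
  (forall x, p x = 0 -> N x) -> (forall x, N x -> p x = 0) ->
  (forall x, N x -> comps_in P N x) ->
  is_grading (fun n y => exists2 x, P n x & y = p x).
Proof.
move=> g surj kN Nk hN; split=> [n|n _ _ [x hx ->] [y hy ->]|y|s f us fP fs].
- by exists 0; [apply: grading0 | rewrite raddf0].
- by exists (x - y); [apply: gradingB | rewrite raddfB].
- have [x ->] := surj y; have [s [f [fP ->]]] := grading_sum g x.
  by exists s, (p \o f); split; [move=> n; exists (f n) | rewrite raddf_sum].
have /choice [h hh] : forall n, exists x, P n x /\ f n = p x.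
  by move=> n; have [x] := fP n; exists x.
have /kN /hN [t [e [ut eP eN et he]]] : p (\sum_(n <- s) h n) = 0.
  by rewrite raddf_sum -[RHS]fs; apply: eq_bigr => n _; case: (hh n).
move=> n ns; have [hP ->] := hh n; apply: Nk.
pose h' n := if n \in s then h n else 0.
have h'E : \sum_(n <- s) h n = \sum_(n <- s) h' n.
  by apply: eq_big_seq => m; rewrite /h' => ->.
have u := undup_uniq (s ++ t).
have h'P m : P m (h' m).
  by rewrite /h'; case: ifP => _; [case: (hh m) | apply: grading0].
have hs : {subset s <= undup (s ++ t)}.
  by move=> m hm; rewrite mem_undup mem_cat hm.
have ht : {subset t <= undup (s ++ t)}.
  by move=> m hm; rewrite mem_undup mem_cat hm orbT.
have h's m : m \notin s -> h' m = 0 by rewrite /h' => /negPf ->.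
have sum0 : \sum_(m <- undup (s ++ t)) (h' m - e m) = 0.
  rewrite sumrB -(sum_supp us u hs h's) -(sum_supp ut u ht et).
  by rewrite -h'E he subrr.
have hP' m : P m (h' m - e m) by apply: gradingB.
have /subr0_eq := grading_direct g u hP' sum0 (hs _ ns).
by rewrite /h' ns => ->.
Qed.


Lemma left_ideal_comps (R : pzRingType) (P : int -> R -> Prop) (S : R -> Prop) :
  is_graded_ring P -> (forall s, S s -> homogeneous P s) ->
  forall x, left_ideal S x -> comps_in P (left_ideal S) x.
Proof.
move=> [g P1 PM] hS x; have I0 := left_ideal0 S.
elim=> [|y z _ hy _ hz|a s Ss]; first exact: comps_in0.
  by apply: comps_inD => //; apply: left_idealD.
have [m Pm] := hS _ Ss.
move: a; apply: (grading_ind g) => [|b c hb hc|n b Pn]; first by rewrite mul0r; apply: comps_in0.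
  by rewrite mulrDl; apply: comps_inD => //; apply: left_idealD.
by apply: (comps_in1 (n := n + m)) => //; [apply: left_idealM | apply: PM].
Qed.

Lemma two_sided_ideal_comps (R : pzRingType) (P : int -> R -> Prop)
    (S : R -> Prop) :
  is_graded_ring P -> (forall s, S s -> homogeneous P s) ->
  forall x, two_sided_ideal S x -> comps_in P (two_sided_ideal S) x.
Proof.
move=> [g P1 PM] hS x; have I0 := two_sided_ideal0 S.
have ID := @two_sided_idealD _ S.
elim=> [|y z _ hy _ hz|a s b Ss]; [exact: comps_in0 | exact: comps_inD |].
have [m Pm] := hS _ Ss.
move: a; apply: (grading_ind g) => [|a a' ha ha'|n a Pn].
- by rewrite !mul0r; apply: comps_in0.
- by rewrite !mulrDl; apply: comps_inD.
move: b; apply: (grading_ind g) => [|b b' hb hb'|p b Pp].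
- by rewrite mulr0; apply: comps_in0.
- by rewrite mulrDr; apply: comps_inD.
apply: (comps_in1 (n := n + m + p)) => //; first exact: two_sided_idealM.
by apply: (PM) => //; apply: PM.
Qed.

Lemma left_quot_grading (R : pzRingType) (P : int -> R -> Prop) (S : R -> Prop) :
  is_graded_ring P -> (forall s, S s -> homogeneous P s) ->
  is_grading (fun n y => exists2 x, P n x & y = left_pi S x).
Proof.
move=> g hS; apply: (quot_grading (graded_ring_grading g) (N := left_ideal S)).
- by move=> y; exists (left_repr y); apply/esym/left_reprK.
- by move=> x h; rewrite -[x]subr0; apply/left_piP; rewrite raddf0.
- by move=> x h; rewrite -[RHS](raddf0 (left_pi S)); apply/left_piP; rewrite subr0.
- exact: left_ideal_comps.
Qed.

Lemma left_quot_scale (R : pzRingType) (P : int -> R -> Prop) (S : R -> Prop) :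
  is_graded_ring P -> forall m n a (y : left_quot S), P m a ->
  (exists2 x, P n x & y = left_pi S x) ->
  exists2 x, P (m + n) x & a *: y = left_pi S x.
Proof.
move=> [_ _ PM] m n a _ Pa [x Px ->].
by exists (a * x); [apply: PM | rewrite left_piZ].
Qed.

Lemma ring_quot_graded (R : pzRingType) (P : int -> R -> Prop) (S : R -> Prop) :
  is_graded_ring P -> (forall s, S s -> homogeneous P s) ->
  is_graded_ring (fun n y => exists2 x, P n x & y = ring_pi S x).
Proof.
move=> g hS; split.
- apply: (quot_grading (graded_ring_grading g) (N := two_sided_ideal S)).
  + by move=> y; exists (ring_repr y); apply/esym/ring_reprK.
  + by move=> x h; rewrite -[x]subr0; apply/ring_piP; rewrite raddf0.
  + by move=> x h; rewrite -[RHS](raddf0 (ring_pi S)); apply/ring_piP; rewrite subr0.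
  + exact: two_sided_ideal_comps.
- by exists 1; [case: g | rewrite rmorph1].
- move=> m n _ _ [x hx ->] [y hy ->].
  by exists (x * y); [case: g => _ _; apply | rewrite rmorphM].
Qed.

End GradedQuotients.

(* The graded left module R / RS, for S a set of homogeneous elements. *)
Definition left_quot_module (R : pzRingType) (P : int -> R -> Prop)
    (g : is_graded_ring P) (S : R -> Prop)
    (hS : forall s, S s -> homogeneous P s) : graded_module P :=
  @GradedModule R P (left_quot S)
    (fun n y => exists2 x, P n x & y = left_pi S x)
    (left_quot_grading g hS) (@left_quot_scale _ _ S g).

Section FreeAlgebra.
Variables (k : fieldType) (n : nat).
Local Notation word := {fmonom 'I_n}.

Local Notation free_alg := {malg k[word]}.

Definition free_var (i : 'I_n) : free_alg := << fmu i >>.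

Definition free_deg (d : int) (f : free_alg) : Prop :=
  forall w, monalg.mcoeff w f != 0 -> (fdeg w)%:Z = d.

Lemma free_degU c (w : word) : free_deg (fdeg w) << c *g w >>.
Proof.
by move=> v; rewrite mcoeffU; case: (w =P v) => [->|] //; rewrite mulr0n eqxx.
Qed.

Lemma free_deg0 d : free_deg d 0.
Proof. by move=> w; rewrite monalg.mcoeff0 eqxx. Qed.

Lemma free_degB d f g : free_deg d f -> free_deg d g -> free_deg d (f - g).
Proof.
move=> hf hg w; rewrite monalg.mcoeffB.
have [e|/hf //] := eqVneq (monalg.mcoeff w f) 0.
by rewrite e sub0r oppr_eq0 => /hg.
Qed.

Lemma free_degD d f g : free_deg d f -> free_deg d g -> free_deg d (f + g).
Proof.
move=> hf hg; rewrite -[g]opprK; apply: free_degB => //.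
by rewrite -sub0r; apply: free_degB => //; apply: free_deg0.
Qed.

Lemma free_degE (f : free_alg) :
  f = \sum_(w <- monalg.msupp f) << monalg.mcoeff w f *g w >>.
Proof. exact: monalgE. Qed.

Lemma free_grading : is_grading free_deg.
Proof.
split=> [d|d x y|f|s f us fP fs d ds].
- exact: free_deg0.
- exact: free_degB.
- pose F (d : int) : free_alg := \sum_(w <- monalg.msupp f | (fdeg w)%:Z == d)
      << monalg.mcoeff w f *g w >>.
  exists (undup [seq (fdeg w)%:Z | w <- monalg.msupp f]), F; split=> [d|].
    rewrite /F; elim/big_ind: _ => [|x y|w /eqP <-]; [exact: free_deg0 | exact: free_degD |].
    exact: free_degU.
  rewrite [LHS]free_degE (exchange_big_dep predT) //=.
  apply: eq_big_seq => w hw.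
  rewrite big_mkcond (bigD1_seq (fdeg w)%:Z) ?undup_uniq ?mem_undup ?map_f //=.
  rewrite eqxx big1 ?addr0 // => d /negPf; rewrite eq_sym => hd.
  by rewrite hd.
apply/malgP => w; rewrite monalg.mcoeff0.
have [e|ne] := eqVneq (fdeg w)%:Z d; last first.
  by apply/eqP; apply: contraNT ne => /(fP d) ->.
have := congr1 (monalg.mcoeff w) fs; rewrite raddf_sum monalg.mcoeff0 /=.
rewrite (bigD1_seq d) //= big1 ?addr0 // => m md.
apply/eqP; apply: contraNT md => /(fP m) <-; exact/eqP.
Qed.

Lemma free_graded_ring : is_graded_ring free_deg.
Proof.
split; first exact: free_grading.
  by have := @free_degU 1 (mone : word); rewrite fdeg1.
move=> d e f g hf hg; rewrite malgME.
rewrite big_seq; elim/big_ind: _ => [|x y|u hu]; [exact: free_deg0 | exact: free_degD |].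
rewrite big_seq; elim/big_ind: _ => [|x y|v hv]; [exact: free_deg0 | exact: free_degD |].
rewrite -(hf u) ?mcoeff_neq0 // -(hg v) ?mcoeff_neq0 // -PoszD -fdegM.
exact: free_degU.
Qed.

Lemma free_var_deg i : free_deg 1 (free_var i).
Proof. by have := @free_degU 1 (fmu i); rewrite fdegU. Qed.


Lemma free_ind (T : free_alg -> Prop) :
  (forall x y, T x -> T y -> T (x + y)) -> (forall c x, T x -> T (c *: x)) ->
  T 1 -> (forall i x, T x -> T (free_var i * x)) -> forall f, T f.
Proof.
move=> TD TZ T1 TX f; rewrite [f]free_degE.
elim/big_ind: _ => [|//|w _]; first by rewrite -(scale0r 1); apply: TZ.
have -> : << monalg.mcoeff w f *g w >> = monalg.mcoeff w f *: << w >> :> free_alg.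
  by apply/malgP => v; rewrite monalg.mcoeffZ !mcoeffU mulr_natr.
apply: (TZ); case: w => s; elim: s => [|i s IH]; first by rewrite -fmoneE.
have -> : << FMonom (i :: s) >> = free_var i * << FMonom s >> :> free_alg.
  rewrite malgM_def fgmulUU mulr1; congr << _ *g _ >>.
  by apply/val_inj; rewrite /= fmM fmU.
exact: TX.
Qed.

Section Evaluation.
Variables (A : algType k) (y : 'I_n -> A).

Definition word_eval (w : word) : A := \prod_(i <- (w : seq _)) y i.

Fact word_eval_mmorphism : mmorphism word_eval.
Proof.
by split=> [u v|]; rewrite /word_eval ?fmM ?big_cat // fm1 big_nil.
Qed.
HB.instance Definition _ := monalg.isMultiplicative.Build word A word_eval
  word_eval_mmorphism.

(* The algebra morphism x_i |-> y_i given by the universal property. *)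
Definition free_eval : free_alg -> A := monalg.mmap (in_alg A) word_eval.

Fact free_eval_zmod : zmod_morphism free_eval.
Proof. exact: (raddfB (monalg.mmap (in_alg A) word_eval)). Qed.
Fact free_eval_monoid : monoid_morphism free_eval.
Proof.
have h (g : free_alg) m m' : GRing.comm (in_alg A (monalg.mcoeff m g)) (word_eval m').
  by rewrite /GRing.comm /= mulr_algl mulr_algr.
by have [hM h1] := @monalg.commr_mmap_is_multiplicative _ _ _ (in_alg A) word_eval h.
Qed.
Fact free_eval_scalable : scalable free_eval.
Proof. by move=> c f; rewrite /free_eval monalg.mmapZ /= mulr_algl. Qed.

HB.instance Definition _ := GRing.isZmodMorphism.Build free_alg A free_eval
  free_eval_zmod.
HB.instance Definition _ := GRing.isMonoidMorphism.Build free_alg A free_eval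
  free_eval_monoid.
HB.instance Definition _ := GRing.isScalable.Build k free_alg A *:%R free_eval
  free_eval_scalable.

Lemma free_eval_var i : free_eval (free_var i) = y i.
Proof. by rewrite /free_eval monalg.mmapU /= scale1r mul1r /word_eval fmU big_seq1. Qed.

End Evaluation.
End FreeAlgebra.

Definition var0 : 'I_4 := ord0.
(* x_1, x_2, x_3 are indexed by i = 0, 1, 2 in 'I_3, and ordS permutes 'I_3
   cyclically, so that (i, ordS i, ordS (ordS i)) are the cyclic
   permutations of (1, 2, 3). *)
Definition var (i : 'I_3) : 'I_4 := lift ord0 i.

Section AlgebraQ.
Variables (k : fieldType) (a b c : k).

Definition alpha_ (i : 'I_3) : k := nth 0 [:: a; b; c] i.

Section Relations.
Variables (A : lalgType k) (x : 'I_4 -> A) (i : 'I_3).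
Local Notation x0 := (x var0).
Local Notation xi := (x (var i)).
Local Notation xj := (x (var (ordS i))).
Local Notation xk := (x (var (ordS (ordS i)))).

Definition relation1 : A :=
  x0 * xi - xi * x0 - alpha_ i *: (xj * xk + xk * xj).
Definition relation2 : A := x0 * xi + xi * x0 - (xj * xk - xk * xj).

End Relations.

Section RelationsMorphism.
Variables (A B : lalgType k) (e : {lrmorphism A -> B}) (x : 'I_4 -> A).

Lemma relation1_morph i : e (relation1 x i) = relation1 (e \o x) i.
Proof.
by rewrite /relation1 !rmorphB /= [e (_ *: _)]linearZ /= rmorphD /= ![e (_ * _)]rmorphM.
Qed.

Lemma relation2_morph i : e (relation2 x i) = relation2 (e \o x) i.
Proof. by rewrite /relation2 !(rmorphB, rmorphD) /= ![e (_ * _)]rmorphM. Qed.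

End RelationsMorphism.

Local Notation F := {malg k[{fmonom 'I_4}]}.

Definition relations (f : F) : Prop :=
  exists i, f = relation1 (@free_var k 4) i \/ f = relation2 (@free_var k 4) i.

Definition Q : Type := ring_quot relations.

HB.instance Definition _ := GRing.PzRing.on Q.

Definition Q_pi : F -> Q := ring_pi relations.
HB.instance Definition _ := GRing.RMorphism.on Q_pi.

Lemma Q_pi_surj (y : Q) : exists f, y = Q_pi f.
Proof. by exists (ring_repr y); rewrite /Q_pi ring_reprK. Qed.

Lemma free_var_coef1 i : monalg.mcoeff mone (@free_var k 4 i) = 0.
Proof.
apply/eqP; apply/negPn/negP => /free_var_deg.
by rewrite fdeg1.
Qed.

Lemma free_coef1M (f g : F) :
  monalg.mcoeff mone (f * g) = monalg.mcoeff mone f * monalg.mcoeff mone g.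
Proof. exact: (rmorphM (monalg.mcoeff (mone : {fmonom 'I_4}))). Qed.

Lemma relations_coef1 f : two_sided_ideal relations f -> monalg.mcoeff mone f = 0.
Proof.
pose Z (g : F) := monalg.mcoeff mone g = 0.
have v0 i g : Z (@free_var k 4 i * g).
  by rewrite /Z free_coef1M free_var_coef1 mul0r.
have ZD g h : Z g -> Z h -> Z (g + h).
  by rewrite /Z monalg.mcoeffD => -> ->; rewrite addr0.
have ZB g h : Z g -> Z h -> Z (g - h).
  by rewrite /Z monalg.mcoeffB => -> ->; rewrite subr0.
have ZZ t g : Z g -> Z (t *: g).
  by rewrite /Z monalg.mcoeffZ => ->; rewrite mulr0.
elim=> [|x y _ hx _ hy|x s y [i hs]]; [exact: monalg.mcoeff0 | exact: ZD |].
rewrite !free_coef1M; have -> : monalg.mcoeff mone s = 0; last by rewrite mulr0 mul0r.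
case: hs => ->; last by apply ZB; [apply ZD | apply ZB].
by apply ZB; [apply ZB | apply ZZ; apply ZD].
Qed.

Fact Q_nonzero : (1 : Q) != 0.
Proof.
apply/eqP; rewrite -(rmorph1 Q_pi) -(rmorph0 Q_pi) => /ring_piP /relations_coef1.
rewrite subr0 monalg.mcoeffU eqxx => /eqP; by rewrite oner_eq0.
Qed.

HB.instance Definition _ := GRing.PzSemiRing_isNonZero.Build Q Q_nonzero.

Definition Q_scale (t : k) (y : Q) : Q := Q_pi (t *: 1) * y.

Lemma Q_scale_pi t f : Q_scale t (Q_pi f) = Q_pi (t *: f).
Proof. by rewrite /Q_scale -(rmorphM Q_pi) mulr_algl. Qed.

Fact Q_scaleA t u y : Q_scale t (Q_scale u y) = Q_scale (t * u) y.
Proof. by have [f ->] := Q_pi_surj y; rewrite !Q_scale_pi scalerA. Qed.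
Fact Q_scale1 : left_id 1 Q_scale.
Proof. by move=> y; have [f ->] := Q_pi_surj y; rewrite Q_scale_pi scale1r. Qed.
Fact Q_scaleDr : right_distributive Q_scale +%R.
Proof. by move=> t y z; apply: mulrDr. Qed.
Fact Q_scaleDl y : {morph Q_scale^~ y : t u / t + u}.
Proof.
by move=> t u; rewrite /Q_scale scalerDl (raddfD Q_pi); apply: mulrDl.
Qed.
HB.instance Definition _ := GRing.Zmodule_isLmodule.Build k Q
  Q_scaleA Q_scale1 Q_scaleDr Q_scaleDl.

Fact Q_scaleAl t (y z : Q) : t *: (y * z) = (t *: y) * z.
Proof. exact: mulrA. Qed.
HB.instance Definition _ := GRing.Lmodule_isLalgebra.Build k Q Q_scaleAl.

Fact Q_scaleAr t (y z : Q) : t *: (y * z) = y * (t *: z).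
Proof.
have [f ->] := Q_pi_surj y; have [g ->] := Q_pi_surj z.
rewrite -[LHS]/(Q_scale _ _) -[t *: _]/(Q_scale _ _).
rewrite -(rmorphM Q_pi) !Q_scale_pi -(rmorphM Q_pi); congr Q_pi.
rewrite -[t *: g]mul_malgC -[LHS]mul_malgC !mulrA; congr (_ * g).
rewrite !malgM_def /=; rewrite [f]free_degE.
rewrite -!malgM_def mulr_sumr mulr_suml; apply: eq_bigr => w _.
by rewrite !malgM_def !fgmulUU mulrC mulm1 mul1m.
Qed.
HB.instance Definition _ := GRing.Lalgebra_isAlgebra.Build k Q Q_scaleAr.

Fact Q_pi_scalable : scalable Q_pi.
Proof. by move=> t f; rewrite -[RHS]/(Q_scale _ _) Q_scale_pi. Qed.
HB.instance Definition _ := GRing.isScalable.Build k F Q *:%R Q_pi Q_pi_scalable.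

Definition Q_var (j : 'I_4) : Q := Q_pi (free_var k j).

Definition Q_deg (n : int) (y : Q) : Prop := exists2 f, free_deg n f & y = Q_pi f.

Lemma relations_homogeneous f : relations f -> homogeneous (@free_deg k 4) f.
Proof.
have [g _ M] := free_graded_ring k 4.
have X (i j : 'I_4) : free_deg (1 + 1) (free_var k i * free_var k j).
  by apply: M; apply: free_var_deg.
have Z t (x : F) : free_deg (1 + 1) x -> free_deg (1 + 1) (t *: x).
  move=> hx w; rewrite monalg.mcoeffZ => h; apply: hx.
  by apply: contra h => /eqP ->; rewrite mulr0.
case=> i [->|->]; exists (1 + 1).
  by apply free_degB; [apply free_degB | apply Z; apply free_degD]; apply X.
by apply free_degB; [apply free_degD | apply free_degB]; apply X.
Qed.

Lemma Q_graded : is_graded_ring Q_deg.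
Proof. exact: (ring_quot_graded (free_graded_ring k 4) relations_homogeneous). Qed.

Lemma Q_var_deg j : Q_deg 1 (Q_var j).
Proof. by exists (free_var k j); [apply: free_var_deg|]. Qed.

(* The morphism out of Q given by images of the generators which satisfy the
   relations. *)
Lemma free_eval_relations (A : algType k) (y : 'I_4 -> A) f g :
  (forall i, relation1 y i = 0 /\ relation2 y i = 0) ->
  Q_pi f = Q_pi g -> free_eval y f = free_eval y g.
Proof.
move=> hy /ring_piP; rewrite -{2}[f](subrK g) raddfD /=.
suff H h : two_sided_ideal relations h -> free_eval y h = 0.
  by move=> /H ->; rewrite add0r.
elim=> [|u v _ hu _ hv|u s v [i hs]]; first exact: raddf0.
  by rewrite raddfD /= hu hv addr0.
rewrite (rmorphM (free_eval y)) (rmorphM (free_eval y)) /=.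
have [h1 h2] := hy i.
suff -> : free_eval y s = 0 by rewrite mulr0 mul0r.
case: hs => ->.
  by rewrite relation1_morph -[RHS]h1 /relation1 /= !free_eval_var.
by rewrite relation2_morph -[RHS]h2 /relation2 /= !free_eval_var.
Qed.

End AlgebraQ.

(* gam i, for i = 0, 1, 2, is the automorphism fixing x_0 and x_(i+1) and
   negating the two other variables. *)
Definition Gamma : finGroupType := ('Z_2 * 'Z_2)%type.

Definition gam (i : 'I_3) : Gamma :=
  nth (0, 0 : 'Z_2) [:: (1 : 'Z_2, 0); (0, 1); (1, 1)] i.

Definition chi_exp (g : Gamma) (j : 'I_4) : nat :=
  nth 0%N [:: 0; g.2 : nat; g.1 : nat; g.1 + g.2]%N j.

(* The sign by which g acts on x_j; see chi_gam for its values. *)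
Definition chi (k : fieldType) (g : Gamma) (j : 'I_4) : k := (-1) ^+ chi_exp g j.

Lemma gam_mul : gam (inord 2) = (gam (inord 0) * gam (inord 1))%g.
Proof. by rewrite /gam !inordK //; apply/eqP. Qed.

Lemma chi_gam (k : fieldType) (i : 'I_3) (j : 'I_4) :
  chi k (gam i) j = if (j == var0) || (j == var i) then 1 else -1.
Proof.
rewrite -!val_eqE /chi /chi_exp /gam /= /bump leq0n add1n.
by case: i j => [[|[|[|//]]] hi] [[|[|[|[|//]]]] hj];
  rewrite /= ?expr0 ?expr1 // -signr_odd.
Qed.

Lemma chiM (k : fieldType) (g h : Gamma) j : chi k (g * h)%g j = chi k g j * chi k h j.
Proof.
rewrite /chi -exprD -[LHS]signr_odd -[RHS]signr_odd /chi_exp; congr (_ ^+ nat_of_bool _).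
by case: g h j => [[[|[|//]] ?] [[|[|//]] ?]] [[[|[|//]] ?] [[|[|//]] ?]]
  [[|[|[|[|//]]]] ?].
Qed.

Lemma chi1 (k : fieldType) j : chi k 1%g j = 1.
Proof. by rewrite /chi /chi_exp; case: j => [[|[|[|[|//]]]] ?]. Qed.

Lemma chiK (k : fieldType) g j : chi k g j * chi k g j = 1.
Proof. by rewrite /chi -exprD addnn -mul2n exprM sqrrN expr1n expr1n. Qed.

Lemma chi_neq0 (k : fieldType) g j : chi k g j != 0.
Proof. by rewrite signr_eq0. Qed.

Lemma chi_var0 (k : fieldType) g : chi k g var0 = 1.
Proof. by []. Qed.

Lemma chi_cyc (k : fieldType) g i :
  chi k g (var (ordS i)) * chi k g (var (ordS (ordS i))) = chi k g (var i).
Proof.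
rewrite /chi -exprD -[LHS]signr_odd -[RHS]signr_odd /chi_exp; congr (_ ^+ nat_of_bool _).
by case: g i => [[[|[|//]] ?] [[|[|//]] ?]] [[|[|[|//]]] ?].
Qed.

Section ScaledRelations.
Variables (k : fieldType) (a b c : k) (A : algType k) (x : 'I_4 -> A).
Variables (s : 'I_4 -> k) (i : 'I_3).
Hypotheses (s0 : s var0 = 1).
Hypothesis (sM : s (var (ordS i)) * s (var (ordS (ordS i))) = s (var i)).

Let scaleM t u (y z : A) : (t *: y) * (u *: z) = (t * u) *: (y * z).
Proof. by rewrite -scalerAl -scalerAr scalerA. Qed.

Lemma relation1_scale :
  relation1 a b c (fun j => s j *: x j) i = s (var i) *: relation1 a b c x i.
Proof.
rewrite /relation1 s0 scale1r !scaleM -scalerAl -scalerAr sM.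
rewrite [s (var (ordS (ordS i))) * _]mulrC sM -scalerDr !scalerA.
by rewrite [alpha_ a b c i * _]mulrC -scalerA -!scalerBr.
Qed.

Lemma relation2_scale :
  relation2 (fun j => s j *: x j) i = s (var i) *: relation2 x i.
Proof.
rewrite /relation2 s0 scale1r !scaleM -scalerAl -scalerAr sM.
by rewrite [s (var (ordS (ordS i))) * _]mulrC sM -scalerDr -!scalerBr.
Qed.

End ScaledRelations.

Section Action.
Variables (k : fieldType) (a b c : k).
Local Notation Q := (Q a b c).

Definition Q_act (g : Gamma) (y : Q) : Q :=
  free_eval (fun j => chi k g j *: Q_var a b c j) (ring_repr y).

Lemma Q_relation i :
  relation1 a b c (Q_var a b c) i = 0 /\ relation2 (Q_var a b c) i = 0.
Proof.
have [h1 h2] : Q_pi a b c (relation1 a b c (@free_var k 4) i) = 0 /\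
    Q_pi a b c (relation2 (@free_var k 4) i) = 0.
  by split; rewrite -[RHS](raddf0 (Q_pi a b c)); apply/ring_piP; rewrite subr0;
    rewrite -[X in two_sided_ideal _ X]mul1r -[X in two_sided_ideal _ X]mulr1;
    constructor; exists i; [left | right].
by rewrite relation1_morph in h1; rewrite relation2_morph in h2.
Qed.

Lemma Q_act_relation g i :
  relation1 a b c (fun j => chi k g j *: Q_var a b c j) i = 0 /\
  relation2 (fun j => chi k g j *: Q_var a b c j) i = 0.
Proof.
have [h1 h2] := Q_relation i.
have h0 := chi_var0 k g; have hc := chi_cyc k g i.
split.
  apply: (etrans (@relation1_scale k a b c Q (Q_var a b c) (chi k g) i h0 hc)).
  by rewrite h1; apply: scaler0.
apply: (etrans (@relation2_scale k Q (Q_var a b c) (chi k g) i h0 hc)).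
by rewrite h2; apply: scaler0.
Qed.

Lemma Q_act_pi g f : Q_act g (Q_pi a b c f) =
  free_eval (fun j => chi k g j *: Q_var a b c j) f.
Proof.
apply: (free_eval_relations (a := a) (b := b) (c := c) (Q_act_relation g)).
exact: ring_reprK.
Qed.

Fact Q_act_zmod g : zmod_morphism (Q_act g).
Proof.
move=> x y; have [f ->] := Q_pi_surj x; have [h ->] := Q_pi_surj y.
by rewrite -raddfB !Q_act_pi raddfB.
Qed.
Fact Q_act_monoid g : monoid_morphism (Q_act g).
Proof.
split=> [|x y]; first by rewrite -[X in Q_act g X](rmorph1 (Q_pi a b c)) Q_act_pi rmorph1.
have [f ->] := Q_pi_surj x; have [h ->] := Q_pi_surj y.
by rewrite -(rmorphM (Q_pi a b c)) !Q_act_pi rmorphM.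
Qed.
Fact Q_act_scalable g : scalable (Q_act g).
Proof.
move=> t x; have [f ->] := Q_pi_surj x.
by rewrite -[t *: Q_pi a b c f]Q_pi_scalable !Q_act_pi linearZ.
Qed.
HB.instance Definition _ g := GRing.isZmodMorphism.Build Q Q (Q_act g)
  (Q_act_zmod g).
HB.instance Definition _ g := GRing.isMonoidMorphism.Build Q Q (Q_act g)
  (Q_act_monoid g).
HB.instance Definition _ g := GRing.isScalable.Build k Q Q *:%R (Q_act g)
  (Q_act_scalable g).

Lemma Q_act_var g j : Q_act g (Q_var a b c j) = chi k g j *: Q_var a b c j.
Proof. by rewrite [in LHS]/Q_var Q_act_pi free_eval_var. Qed.

Lemma Q_ind (T : Q -> Prop) :
  (forall x y, T x -> T y -> T (x + y)) -> (forall t x, T x -> T (t *: x)) ->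
  T 1 -> (forall j x, T x -> T (Q_var a b c j * x)) -> forall x, T x.
Proof.
move=> TD TZ T1 TX x; have [f ->] := Q_pi_surj x.
elim/free_ind: f => [f g hf hg|t f hf||j f hf].
- by rewrite raddfD; apply: TD.
- by rewrite linearZ; apply: TZ.
- by rewrite rmorph1.
- by rewrite rmorphM; apply: TX.
Qed.

Lemma Q_actM g h x : Q_act (g * h)%g x = Q_act g (Q_act h x).
Proof.
elim/Q_ind: x => [x y hx hy|t x hx||j x hx].
- by rewrite !raddfD /= hx hy.
- by rewrite !linearZ /= hx.
- by rewrite !rmorph1.
by rewrite !rmorphM /= hx !Q_act_var linearZ /= Q_act_var scalerA chiM mulrC.
Qed.

Lemma Q_act1 x : Q_act 1%g x = x.
Proof.
elim/Q_ind: x => [x y hx hy|t x hx||j x hx].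
- by rewrite raddfD /= hx hy.
- by rewrite linearZ /= hx.
- by rewrite rmorph1.
by rewrite rmorphM /= hx Q_act_var chi1 scale1r.
Qed.

Lemma Q_act_deg g n x : Q_deg n x -> Q_deg n (Q_act g x).
Proof.
have [G G1 GM] := Q_graded a b c.
have GZ t m y : Q_deg m y -> Q_deg m (t *: y : Q).
  case=> f hf ->; exists (t *: f); last by rewrite linearZ.
  move=> w; rewrite monalg.mcoeffZ => h; apply: hf.
  by apply: contra h => /eqP ->; rewrite mulr0.
case=> f hf ->; rewrite Q_act_pi /free_eval /monalg.mmap big_seq.
elim/big_ind: _ => [|x1 x2|w hw]; [exact: grading0 | exact: gradingD |].
rewrite /= mulr_algl; apply: (GZ); rewrite -(hf w) ?mcoeff_neq0 //.
case: w {hw} => s; rewrite /word_eval /fdeg /=.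
elim: s => [|j s IH]; first by rewrite big_nil.
rewrite big_cons /= -add1n PoszD; apply: GM => //.
exact/GZ/Q_var_deg.
Qed.

End Action.

Section Geometry.
Variable k : closedFieldType.

(* Vectors of Q_1^* and linear forms are both given by their coordinates
   with respect to x_0, ..., x_3. *)
Definition linear_form (l : 'rV[k]_4) : {mpoly k[4]} := \sum_j l 0 j *: 'X_j.

(* P(Q_1^* ), as the set of one-dimensional subspaces of Q_1^* = k^4. *)
Definition P3 := {p : {vspace 'rV[k]_4} | \dim p == 1%N}.

Definition sign_change (g : Gamma) (v : 'rV[k]_4) : 'rV[k]_4 :=
  \row_j (chi k g j * v 0 j).

Fact sign_change_linear g : linear (sign_change g).
Proof. by move=> t u v; apply/rowP=> j; rewrite !mxE mulrDr mulrCA. Qed.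
HB.instance Definition _ g := GRing.isLinear.Build k 'rV[k]_4 'rV[k]_4 *:%R
  (sign_change g) (sign_change_linear g).

Lemma sign_changeK g : involutive (sign_change g).
Proof. by move=> v; apply/rowP=> j; rewrite !mxE mulrA chiK mul1r. Qed.

Fact P3_act_dim g (p : P3) : \dim (linfun (sign_change g) @: val p) == 1%N.
Proof.
rewrite limg_dim_eq ?(eqP (valP p)) //.
suff -> : lker (linfun (sign_change g)) = 0%VS by rewrite capv0.
apply/eqP/lker0P => u v; rewrite !lfunE => h.
by rewrite -[u](sign_changeK g) /= h sign_changeK.
Qed.
Definition P3_act (g : Gamma) (p : P3) : P3 :=
  exist _ (linfun (sign_change g) @: val p)%VS (P3_act_dim g p).

Variables (a c : k).

Definition quadric1 : {mpoly k[4]} := \sum_j 'X_j ^+ 2.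
Definition quadric2 : {mpoly k[4]} :=
  (1 - c) *: 'X_(var 0) ^+ 2 + (1 + a * c) *: 'X_(var 1) ^+ 2
  + (1 + a) *: 'X_(var 2) ^+ 2.

Definition on_curve (p : P3) : Prop :=
  forall v, v \in val p ->
    quadric1.@[v ord0] = 0 /\ quadric2.@[v ord0] = 0.

Definition curve := {p : P3 | `[< on_curve p >]}.

Fact curve_act_proof g (p : curve) : `[< on_curve (P3_act g (val p)) >].
Proof.
apply/asboolP => _ /memv_imgP [v hv ->]; rewrite lfunE /=.
have /asboolP /(_ v hv) [h1 h2] := valP p.
have sq j : sign_change g v ord0 j ^+ 2 = v ord0 j ^+ 2.
  by rewrite mxE exprMn expr2 chiK mul1r.
split.
  rewrite -[RHS]h1 /quadric1 !raddf_sum /=; apply: eq_bigr => j _.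
  by rewrite !rmorphXn /= !mevalXU sq.
rewrite -[RHS]h2 /quadric2 !mevalD !mevalZ !rmorphXn /= !mevalXU.
by rewrite !sq.
Qed.
Definition curve_act (g : Gamma) (p : curve) : curve :=
  exist _ (P3_act g (val p)) (curve_act_proof g p).

(* Morphisms of varieties E -> E and E x E -> E: locally given by (bi)homogeneous
   polynomials of the same (bi)degree. *)
Definition is_morphism (f : curve -> curve) : Prop :=
  forall p : curve, exists (d : nat) (F : 'I_4 -> {mpoly k[4]}),
  [/\ forall j, F j \is d.-homog,
      exists2 v, v \in val (val p) & \row_j (F j).@[v ord0] != 0
    & forall (q : curve) v, v \in val (val q) ->
        \row_j (F j).@[v ord0] \in val (val (f q))].

Definition bihomogeneous (d e : nat) (F : {mpoly k[4 + 4]}) : Prop :=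
  forall m, m \in mpoly.msupp F ->
    (\sum_j m (lshift 4 j))%N = d /\ (\sum_j m (rshift 4 j))%N = e.

Definition is_bimorphism (f : curve -> curve -> curve) : Prop :=
  forall p q : curve, exists (d e : nat) (F : 'I_4 -> {mpoly k[4 + 4]}),
  [/\ forall j, bihomogeneous d e (F j),
      exists v w, [/\ v \in val (val p), w \in val (val q)
        & \row_j (F j).@[row_mx v w ord0] != 0]
    & forall (p' q' : curve) v w, v \in val (val p') -> w \in val (val q') ->
        \row_j (F j).@[row_mx v w ord0] \in val (val (f p' q'))].

Record algebraic_group_law := AlgebraicGroupLaw {
  E_zero : curve;
  E_opp : curve -> curve;
  E_add : curve -> curve -> curve;
  E_addA : associative E_add;
  E_addC : commutative E_add;
  E_add0 : left_id E_zero E_add;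
  E_addN : left_inverse E_zero E_opp E_add;
  E_opp_morphism : is_morphism E_opp;
  E_add_morphism : is_bimorphism E_add }.

(* Closed subschemes of P^3 are given by homogeneous ideals, and two such
   ideals define the same subscheme iff they agree in all large degrees. *)
Definition same_subscheme (I J : {mpoly k[4]} -> Prop) : Prop :=
  exists d0, forall d F, (d0 <= d)%N -> F \is d.-homog -> (I F <-> J F).

(* As k is infinite, these are the polynomials all of whose homogeneous
   components vanish at p. *)
Definition point_ideal (p : P3) (F : {mpoly k[4]}) : Prop :=
  forall v, v \in val p -> F.@[v ord0] = 0.

(* The ideal of the divisor (p) + (q) of E, whose ideal sheaf in O_E is the
   product of the ideal sheaves of p and q. *)
Definition divisor_ideal (p q : curve) : {mpoly k[4]} -> Prop :=
  left_ideal (fun F => [\/ F = quadric1, F = quadric2 |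
    exists G H, [/\ point_ideal (val p) G, point_ideal (val q) H & F = G * H]]).

Definition section_ideal (x x' : 'rV[k]_4) : {mpoly k[4]} -> Prop :=
  left_ideal (fun F => F \in
    [:: quadric1; quadric2; linear_form x; linear_form x']).

(* The line x = x' = 0 meets E, scheme-theoretically, in the divisor (p) + (q). *)
Definition is_secant (p q : curve) (x x' : 'rV[k]_4) : Prop :=
  free [:: x; x'] /\ same_subscheme (section_ideal x x') (divisor_ideal p q).

End Geometry.

Section Modules.
Variables (k : closedFieldType) (a b c : k).
Local Notation Q := (Q a b c).

Definition graded_Qmodule := graded_module (@Q_deg k a b c).

(* twist g M is M with the action of r given by that of g^-1(r). *)
Definition twist_sort (g : Gamma) (M : lmodType Q) : Type := M.

Section Twist.
Variables (g : Gamma) (M : lmodType Q).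
HB.instance Definition _ := GRing.Zmodule.on (twist_sort g M).

Definition twist_scale (r : Q) (m : twist_sort g M) : twist_sort g M :=
  Q_act g^-1%g r *: (m : M).

Fact twist_scaleA r s m : twist_scale r (twist_scale s m) = twist_scale (r * s) m.
Proof. by rewrite /twist_scale [Q_act _ (r * s)]rmorphM; apply: (@scalerA _ M). Qed.
Fact twist_scale1 : left_id 1 twist_scale.
Proof. by move=> m; rewrite /twist_scale [Q_act _ 1]rmorph1; apply: (@scale1r _ M). Qed.
Fact twist_scaleDr : right_distributive twist_scale +%R.
Proof. by move=> r m n; apply: (@scalerDr _ M). Qed.
Fact twist_scaleDl m : {morph twist_scale^~ m : r s / r + s}.
Proof. by move=> r s; rewrite /twist_scale [Q_act _ (r + s)]raddfD; apply: (@scalerDl _ M). Qed.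
HB.instance Definition _ := GRing.Zmodule_isLmodule.Build Q (twist_sort g M)
  twist_scaleA twist_scale1 twist_scaleDr twist_scaleDl.
End Twist.

Fact twist_deg_scale g (M : graded_Qmodule) m n r (x : twist_sort g M) :
  Q_deg m r -> gm_deg n (x : M) -> gm_deg (m + n) ((r *: x : twist_sort g M) : M).
Proof. by move=> hr hx; apply: gm_scale => //; apply: Q_act_deg. Qed.

Definition twist (g : Gamma) (M : graded_Qmodule) : graded_Qmodule :=
  @GradedModule _ _ (twist_sort g M) (@gm_deg _ _ M) (gm_grading M)
    (@twist_deg_scale g M).

Definition Q_form (l : 'rV[k]_4) : Q := \sum_j l 0 j *: Q_var a b c j.

Lemma Q_form_deg l : Q_deg 1 (Q_form l).
Proof.
exists (\sum_j l 0 j *: free_var k j).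
  elim/big_ind: _ => [|x y|j _]; [exact: free_deg0 | exact: free_degD |].
  move=> w; rewrite monalg.mcoeffZ => h; apply: (@free_var_deg k 4 j).
  by apply: contra h => /eqP ->; rewrite mulr0.
by rewrite (raddf_sum (Q_pi a b c)); apply: eq_bigr => j _; apply/esym/Q_pi_scalable.
Qed.

Definition point_gens (p : P3 k) (y : Q) : Prop :=
  exists2 l : 'rV[k]_4,
    forall v, v \in val p -> \sum_j l 0 j * v 0 j = 0 & y = Q_form l.

Fact point_gens_homogeneous p y : point_gens p y -> homogeneous (@Q_deg k a b c) y.
Proof. by case=> l _ ->; exists 1; apply: Q_form_deg. Qed.

Definition point_module (p : P3 k) : graded_Qmodule :=
  left_quot_module (Q_graded a b c) (@point_gens_homogeneous p).

Definition line_gens (x x' : 'rV[k]_4) (y : Q) : Prop :=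
  y = Q_form x \/ y = Q_form x'.

Fact line_gens_homogeneous x x' y :
  line_gens x x' y -> homogeneous (@Q_deg k a b c) y.
Proof. by case=> ->; exists 1; apply: Q_form_deg. Qed.

Definition line_module (x x' : 'rV[k]_4) : graded_Qmodule :=
  left_quot_module (Q_graded a b c) (@line_gens_homogeneous x x').

End Modules.

(* Main.v *)
(* For an automorphism g of Q, the map [r] |-> [g r] identifies the twist of
   Q/QS by g with Q/Q(gS); so it suffices to compare generators. Translation by
   xi_i is the sign change gamma_i, which settles point modules. For line modules
   the span of x and x' must be recovered from the divisor (p) + (q). Since
   X_j^d x lies in its ideal for large d and all j, the form x vanishes at p and
   q; if p = q, comparing gradients at p puts x in the span of the gradients of
   the two quadrics. Either way x and x' lie in a space of dimension at most 2
   which is compatible with sign changes, so they span it. *)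
Require Import Defs.
From mathcomp Require Import all_boot all_order all_algebra all_fingroup.
From HB Require Import structures.
From mathcomp Require Import boolp mpoly.

Set Implicit Arguments.
Unset Strict Implicit.
Unset Printing Implicit Defensive.

Import GRing.Theory.
Local Open Scope ring_scope.

(** * Twists of cyclic modules [Q/QS] *)

Section TwistedQuotient.
Variables (k : closedFieldType) (a b c : k) (g : Gamma).
Local Notation Q := (Q a b c).
Variables S T : Q -> Prop.
Hypothesis hS : forall s, S s -> homogeneous (@Q_deg k a b c) s.
Hypothesis hT : forall t, T t -> homogeneous (@Q_deg k a b c) t.
Hypothesis ST : forall s, S s -> left_ideal T (Q_act g s).
Hypothesis TS : forall t, T t -> left_ideal S (Q_act g^-1%g t).

Let M := twist g (left_quot_module (Q_graded a b c) hS).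
Let N := left_quot_module (Q_graded a b c) hT.

(** Needed for [g], to define the map, and for [g^-1], to invert it; hence an arbitrary [h]. *)
Lemma left_ideal_act (h : Gamma) (A B : Q -> Prop) r :
  (forall s, A s -> left_ideal B (Q_act h s)) ->
  left_ideal A r -> left_ideal B (Q_act h r).
Proof.
move=> AB; elim=> [|u v _ hu _ hv|u s /AB hs].
- by rewrite raddf0; apply: left_ideal0.
- rewrite raddfD /=; exact: left_idealD hu hv.
by rewrite rmorphM /=; apply: left_ideal_mull.
Qed.

Definition twist_quot_map (m : M) : N :=
  left_pi T (Q_act g (left_repr (m : left_quot S))).

Lemma twist_quot_mapE r : twist_quot_map (left_pi S r) = left_pi T (Q_act g r).
Proof.
apply/left_piP; rewrite -raddfB; apply: (left_ideal_act ST).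
by apply/left_piP; rewrite left_reprK.
Qed.

Fact twist_quot_map_linear : linear twist_quot_map.
Proof.
move=> r m n; rewrite -[m](@left_reprK _ S) -[n](@left_reprK _ S).
set u := left_repr m; set v := left_repr n.
(* In the twist [r] acts through [g^-1]; applying [g] afterwards turns this back into [r]. *)
have -> : r *: (left_pi S u : M) + (left_pi S v : M) =
    left_pi S (Q_act g^-1%g r * u + v) :> left_quot S.
  by rewrite raddfD /= left_piZ.
rewrite !twist_quot_mapE raddfD /= rmorphM /= -Q_actM mulgV Q_act1 raddfD /= left_piZ.
reflexivity.
Qed.
HB.instance Definition _ := GRing.isLinear.Build Q M N *:%R twist_quot_map
  twist_quot_map_linear.

Lemma twist_left_quot_iso : graded_iso M N.
Proof.
exists (twist_quot_map : {linear M -> N}); split.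
  exists (fun n : N => left_pi S (Q_act g^-1%g (left_repr (n : left_quot T)))).
    move=> m; rewrite -[m in RHS](@left_reprK _ S); apply/left_piP.
    (* Inserting [g^-1 g] in the second term exhibits the difference as [g^-1] of an element of
       [QT]. *)
    rewrite -[X in _ - X]Q_act1 -(mulVg g) Q_actM -raddfB.
    apply: (left_ideal_act TS); apply/left_piP.
    by rewrite left_reprK.
  move=> n; apply: etrans (twist_quot_mapE _) _; rewrite -Q_actM mulgV Q_act1.
  exact: left_reprK.
move=> d m; split=> -[r dr e].
  by exists (Q_act g r); [apply: Q_act_deg | rewrite e; apply: twist_quot_mapE].
exists (Q_act g^-1%g r); first exact: Q_act_deg.
rewrite -[m](@left_reprK _ S); apply/left_piP.
rewrite -[X in left_ideal S (X - _)]Q_act1 -(mulVg g) Q_actM -raddfB.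
by apply: (left_ideal_act TS); apply/left_piP.
Qed.

End TwistedQuotient.

(** * Sign changes of linear forms *)

Section Forms.
Variables (k : closedFieldType) (a b c : k).

Lemma chiV (g : Gamma) j : chi k g^-1%g j = chi k g j.
Proof. by apply: (mulfI (chi_neq0 k g j)); rewrite -chiM mulgV chi1 chiK. Qed.

Lemma sign_changeV (g : Gamma) (l : 'rV[k]_4) :
  sign_change g^-1%g l = sign_change g l.
Proof. by apply/rowP=> j; rewrite !mxE chiV. Qed.

Lemma Q_act_form g (l : 'rV[k]_4) :
  Q_act g (Q_form a b c l) = Q_form a b c (sign_change g l).
Proof.
rewrite /Q_form raddf_sum; apply: eq_bigr => j _ /=.
by rewrite linearZ /= Q_act_var scalerA mxE mulrC.
Qed.

Lemma Q_formD (x y : 'rV[k]_4) :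
  Q_form a b c (x + y) = Q_form a b c x + Q_form a b c y.
Proof.
by rewrite /Q_form -big_split; apply: eq_bigr => j _; rewrite mxE scalerDl.
Qed.

(** The scalar becomes the element [t *: 1] of [Q], so that scalar multiples of a generator are left
    multiples of it. *)
Lemma Q_formZ t (x : 'rV[k]_4) : Q_form a b c (t *: x) = (t *: 1) * Q_form a b c x.
Proof.
rewrite -(scalerAl t 1 (Q_form a b c x)) mul1r /Q_form scaler_sumr.
by apply: eq_bigr => j _; rewrite mxE scalerA.
Qed.

(** Sign changes are self-adjoint involutions for the pairing of forms with vectors, so they carry
    the forms vanishing at [p] onto those vanishing at its image. *)
Lemma twist_point_module g (p : P3 k) :
  graded_iso (twist g (point_module a b c p))
             (point_module a b c (P3_act g p)).
Proof.
have act_gen h (p' : P3 k) (l : 'rV[k]_4) : (forall v, v \in val (P3_act h p') ->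
    \sum_j l 0 j * v 0 j = 0) ->
    forall v, v \in val p' -> \sum_j sign_change h l 0 j * v 0 j = 0.
  move=> hl v vp; rewrite -[RHS](hl (sign_change h v)).
    by apply: eq_bigr => j _; rewrite !mxE -mulrA mulrCA.
  by rewrite /= -[sign_change h v](lfunE (sign_change h)); apply: memv_img.
apply: twist_left_quot_iso => [_ [l hl ->]|_ [l hl ->]];
  rewrite Q_act_form ?sign_changeV -[Q_form _ _ _ _]mul1r;
  apply: left_idealM; exists (sign_change g l) => //; last exact: act_gen.
move=> _ /memv_imgP [v vp ->]; rewrite lfunE -[RHS](hl v vp).
by apply: eq_bigr => j _; rewrite !mxE mulrACA chiK mul1r.
Qed.

Lemma sub_adds_rVP n (l x y : 'rV[k]_n) :
  reflect (exists s t, l = s *: x + t *: y) (l <= x + y)%MS.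
Proof.
apply: (iffP sub_addsmxP) => [[[s t] /= ->]|[s [t ->]]].
  exists (s 0 0), (t 0 0).
  by rewrite {1}(mx11_scalar s) {1}(mx11_scalar t) !mul_scalar_mx.
by exists (s%:M, t%:M); rewrite /= !mul_scalar_mx.
Qed.

(** The left ideal depends only on the span of its two generators. As a sign change is its own
    inverse, the last two inclusions handle [g^-1]. *)
Lemma twist_line_module_eq g (x x' y y' : 'rV[k]_4) :
  (sign_change g x <= y + y')%MS -> (sign_change g x' <= y + y')%MS ->
  (sign_change g y <= x + x')%MS -> (sign_change g y' <= x + x')%MS ->
  graded_iso (twist g (line_module a b c x x')) (line_module a b c y y').
Proof.
have gen l z z' : (l <= z + z')%MS ->
    left_ideal (line_gens z z') (Q_form a b c l).
  case/sub_adds_rVP=> s [t ->]; rewrite Q_formD !Q_formZ.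
  by apply: left_idealD; apply: left_idealM; [left | right].
move=> xy x'y yx y'x; apply: twist_left_quot_iso => s [] ->;
  by rewrite Q_act_form ?sign_changeV; apply: gen.
Qed.

Lemma rank_adds_rV n (v w : 'rV[k]_n) :
  w != 0 -> ~~ (v <= w)%MS -> \rank (v + w)%MS = 2%N.
Proof.
move=> w0 vw; apply/eqP; rewrite eqn_leq; apply/andP; split.
  by apply: leq_trans (mxrank_adds_leqif v w) _; rewrite !rank_rV w0; case: (v != 0).
have := ltn_leqif (mxrank_leqif_sup (addsmxSr v w)).
by rewrite rank_rV w0 addsmx_sub submx_refl andbT vw => ->.
Qed.

Lemma free2_rank n (x y : 'rV[k]_n) :
  free [:: x; y] -> \rank (x + y)%MS = 2%N.
Proof.
rewrite free_cons span_seq1 seq1_free => /andP [xy y0].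
apply: rank_adds_rV => //; apply: contra xy => /sub_rVP [t ->].
exact/rpredZ/memv_line.
Qed.

End Forms.

(** * Gradients of polynomials at a vector *)

Section Gradient.
Variables (k : closedFieldType) (n : nat).
Local Notation P := (mpoly n k).

Definition gradient (v : 'rV[k]_n) (F : P) : 'rV[k]_n :=
  \row_j (mderiv j F).@[v ord0].

Fact gradient_linear v : linear (gradient v).
Proof. by move=> t F G; apply/rowP=> j; rewrite !mxE linearP mevalD mevalZ. Qed.
HB.instance Definition _ v := GRing.isLinear.Build k P 'rV[k]_n *:%R
  (gradient v) (gradient_linear v).

Lemma gradientM v (F H : P) :
  gradient v (F * H) = F.@[v ord0] *: gradient v H + H.@[v ord0] *: gradient v F.
Proof.
apply/rowP=> j; rewrite !mxE mderivM mevalD !mevalM addrC; congr (_ + _).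
exact: mulrC.
Qed.

Lemma gradient_var v j : gradient v 'X_j = delta_mx 0 j.
Proof.
apply/rowP=> i; rewrite !mxE mderivX mevalZ mnm1E eqxx /= eq_sym.
case: eqP => [->|]; last by rewrite mul0r.
by rewrite mul1r mevalX big1 // => m _; rewrite mnmBE subnn.
Qed.

End Gradient.

(** * Recovering a secant line from its divisor *)

Section Secants.
Variables (k : closedFieldType) (a c : k).
Implicit Types (v w l x y : 'rV[k]_4) (p q : curve a c) (g : Gamma).

Lemma linear_formE l v : (linear_form l).@[v ord0] = \sum_j l 0 j * v 0 j.
Proof.
rewrite /linear_form raddf_sum /=; apply: eq_bigr => j _.
by rewrite mevalZ mevalXU.
Qed.

Lemma gradient_linear_form l v : gradient v (linear_form l) = l.
Proof.
rewrite /linear_form raddf_sum [RHS]row_sum_delta; apply: eq_bigr => j _ /=.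
by rewrite linearZ /= gradient_var.
Qed.

(** The gradient is [2 v_j] times the [j]-th unit vector, so it takes the sign of [v_j]. *)
Lemma gradient_sqr_sign g v j :
  gradient (sign_change g v) ('X_j ^+ 2) = sign_change g (gradient v ('X_j ^+ 2)).
Proof.
rewrite expr2 !gradientM !gradient_var !mevalXU; apply/rowP=> i; rewrite !mxE eqxx /=.
case: (i =P j) => [->|_]; last by rewrite !mulr0 !addr0 mulr0.
by rewrite !mulr1 mulrDr.
Qed.

Lemma gradient_quadric1_sign g v :
  gradient (sign_change g v) (quadric1 k) = sign_change g (gradient v (quadric1 k)).
Proof.
by rewrite /quadric1 !raddf_sum /=; apply: eq_bigr => j _; apply: gradient_sqr_sign.
Qed.

Lemma gradient_quadric2_sign g v :
  gradient (sign_change g v) (quadric2 a c) =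
  sign_change g (gradient v (quadric2 a c)).
Proof.
have E w : gradient w (quadric2 a c) = (1 - c) *: gradient w ('X_(var 0) ^+ 2)
    + (1 + a * c) *: gradient w ('X_(var 1) ^+ 2)
    + (1 + a) *: gradient w ('X_(var 2) ^+ 2).
  by rewrite linearD /= linearD /= !linearZ.
by rewrite !E !gradient_sqr_sign 2!linearD /= !linearZ.
Qed.

(* The row space consists of the linear forms vanishing at v and w or, when
   v and w are the same point of P^3, on the tangent line to E there. *)
Definition secant_mx v w : 'M[k]_4 :=
  if (v <= w)%MS then (gradient v (quadric1 k) + gradient v (quadric2 a c))%MS
  else kermx (col_mx v w)^T.

Lemma sub_ker_col2 l v w :
  (l <= kermx (col_mx v w)^T)%MS = (l *m v^T == 0) && (l *m w^T == 0).
Proof.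
rewrite tr_col_mx -row_mx_eq0 -mul_mx_row.
by apply/sub_kermxP/eqP.
Qed.

(** Two gradients span at most a plane; in the other case [v] and [w] are independent and the kernel
    has dimension 4 - 2. *)
Lemma rank_secant_mx v w : w != 0 -> (\rank (secant_mx v w) <= 2)%N.
Proof.
move=> w0; rewrite /secant_mx; case: ifPn => vw.
  by apply: leq_trans (mxrank_adds_leqif _ _) _; rewrite (leq_add (rank_leq_row _) (rank_leq_row _)).
by rewrite mxrank_ker mxrank_tr -addsmxE rank_adds_rV.
Qed.

(** Makes the case distinction in [secant_mx] invariant under sign changes. *)
Lemma sign_change_sub g v w :
  (sign_change g v <= sign_change g w)%MS = (v <= w)%MS.
Proof.
have h v' w' : (v' <= w')%MS -> (sign_change g v' <= sign_change g w')%MS.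
  by case/sub_rVP=> t ->; rewrite linearZ; apply: scalemx_sub.
by apply/idP/idP => [/h|/h //]; rewrite !sign_changeK.
Qed.

Lemma secant_mx_sign g v w l :
  (l <= secant_mx v w)%MS ->
  (sign_change g l <= secant_mx (sign_change g v) (sign_change g w))%MS.
Proof.
rewrite /secant_mx sign_change_sub; case: ifP => _.
  case/sub_adds_rVP=> s [t ->]; apply/sub_adds_rVP; exists s, t.
  by rewrite gradient_quadric1_sign gradient_quadric2_sign linearD !linearZ.
have h u : sign_change g l *m (sign_change g u)^T = l *m u^T.
  apply/matrixP=> i j; rewrite !mxE; apply: eq_bigr => m _.
  by rewrite !mxE mulrACA chiK mul1r !ord1.
by rewrite !sub_ker_col2 !h.
Qed.

(** The ideals are known to agree only in large degrees, so the form is multiplied by a power of a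
    variable. Every [j] is allowed, so that a coordinate nonzero at a given point can be chosen
    later. *)
Lemma secant_form_divisor p q x x' l : is_secant p q x x' -> l \in [:: x; x'] ->
  exists d, forall j, divisor_ideal p q ('X_j ^+ d * linear_form l).
Proof.
case=> _ [d sub] lx; exists d => j; apply/(sub d.+1) => //.
  rewrite -(addn1 d); apply: dhomogM.
    by rewrite mpolyXn dhomogX; apply/eqP; rewrite /= mdegMn mdeg1 mul1n.
  by apply: rpred_sum => i _; apply: rpredZ; rewrite dhomogX /= mdeg1.
apply: left_idealM; move: lx; rewrite !inE => /orP [] /eqP ->;
  by rewrite eqxx ?orbT.
Qed.

Lemma divisor_ideal_vanish p q v F : divisor_ideal p q F ->
  (v \in val (val p)) || (v \in val (val q)) -> F.@[v ord0] = 0.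
Proof.
move=> hF hv; elim: hF => [|F1 F2 _ h1 _ h2|A F1 hF1]; first exact: meval0.
  by rewrite mevalD h1 h2 addr0.
rewrite mevalM; suff -> : F1.@[v ord0] = 0 by rewrite mulr0.
have [r vr] : exists r : curve a c, v \in val (val r).
  by case/orP: hv; [exists p | exists q].
have /asboolP /(_ v vr) [h1 h2] := valP r.
case: hF1 => [->|->|[F2 [H [hF hH ->]]]] //.
rewrite mevalM; case/orP: hv => [/hF ->|/hH ->]; by rewrite ?mul0r ?mulr0.
Qed.

(** By the Leibniz rule a multiple of a generator vanishing at [v] has gradient proportional to that
    of the generator; a product of two factors vanishing at [v] has gradient zero. *)
Lemma divisor_ideal_gradient p q v F : divisor_ideal p q F ->
  v \in val (val p) -> v \in val (val q) ->
  (gradient v F <= gradient v (quadric1 k) + gradient v (quadric2 a c))%MS.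
Proof.
move=> hF vp vq; elim: hF => [|F1 F2 _ h1 _ h2|A F1 hF1].
- by rewrite raddf0 sub0mx.
- by rewrite raddfD addmx_sub.
have F10 : F1.@[v ord0] = 0.
  apply: (@divisor_ideal_vanish p q); last by rewrite vp.
  by rewrite -[F1]mul1r; apply: left_idealM.
rewrite gradientM F10 scale0r addr0 scalemx_sub //.
case: hF1 {F10} => [->|->|[F2 [H [hF hH ->]]]].
- exact: addsmxSl.
- exact: addsmxSr.
by rewrite gradientM hF // hH // !scale0r addr0 sub0mx.
Qed.

Lemma secant_form_vanish p q x x' l v : is_secant p q x x' ->
  l \in [:: x; x'] -> (v \in val (val p)) || (v \in val (val q)) ->
  (linear_form l).@[v ord0] = 0.
Proof.
move=> sec lx hv; have [v0|/rV0Pn [j vj]] := eqVneq v 0.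
  by rewrite linear_formE big1 // => j _; rewrite v0 mxE mulr0.
have [d /(_ j) hF] := secant_form_divisor sec lx.
have /eqP := divisor_ideal_vanish hF hv.
rewrite mevalM rmorphXn /= mevalXU mulf_eq0 expf_eq0 => /orP [/andP [_]|/eqP //].
by rewrite (negPf vj).
Qed.

Lemma secant_form_sub p q x x' l v w : is_secant p q x x' ->
  l \in [:: x; x'] -> v \in val (val p) -> w \in val (val q) -> v != 0 ->
  (l <= secant_mx v w)%MS.
Proof.
move=> sec lx vp wq v0; rewrite /secant_mx; case: ifPn => [/sub_rVP [t vw]|_].
  have vq : v \in val (val q) by rewrite vw rpredZ.
  have [j vj] := rV0Pn _ v0.
  have [d /(_ j) hF] := secant_form_divisor sec lx.
  have := divisor_ideal_gradient hF vp vq.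
  (* The form vanishes at [v], so Leibniz leaves only [v_j ^+ d *: l], with an invertible scalar. *)
  rewrite gradientM (secant_form_vanish sec lx) ?vp // scale0r addr0.
  rewrite gradient_linear_form rmorphXn /= mevalXU.
  by rewrite (eqmx_scale _ (expf_neq0 d vj)).
have h u : (u \in val (val p)) || (u \in val (val q)) -> l *m u^T == 0.
  move=> /(secant_form_vanish sec lx); rewrite linear_formE => lu.
  apply/eqP/matrixP=> i j; rewrite !mxE -[RHS]lu !ord1.
  by apply: eq_bigr => m _; rewrite mxE.
by rewrite sub_ker_col2 !h // ?vp ?wq ?orbT.
Qed.

(** The span of [x] and [x'] has rank 2, the upper bound for the space containing it, so inclusion
    is equality. *)
Lemma secant_eqmx p q x x' v w : is_secant p q x x' ->
  v \in val (val p) -> w \in val (val q) -> v != 0 -> w != 0 ->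
  (x + x' :=: secant_mx v w)%MS.
Proof.
move=> sec vp wq v0 w0; have [fr _] := sec; apply/eqmxP.
have sub : (x + x' <= secant_mx v w)%MS.
  by rewrite addsmx_sub !(secant_form_sub sec _ vp wq) ?inE ?eqxx ?orbT.
rewrite -(geq_leqif (mxrank_leqif_eq sub)) (free2_rank fr).
exact: rank_secant_mx.
Qed.

Lemma point_neq0 (p : P3 k) : exists2 v, v \in val p & v != 0.
Proof.
exists (vpick (val p)); first exact: memv_pick.
by rewrite vpick0 -dimv_eq0 (eqP (valP p)).
Qed.

Lemma secant_sign_change g p q x x' y y' : is_secant p q x x' ->
  is_secant (curve_act g p) (curve_act g q) y y' ->
  [/\ sign_change g x <= y + y', sign_change g x' <= y + y',
      sign_change g y <= x + x' & sign_change g y' <= x + x']%MS.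
Proof.
move=> sx sy; have [v vp v0] := point_neq0 (val p).
have [w wq w0] := point_neq0 (val q).
have img (r : curve a c) u : u \in val (val r) ->
    sign_change g u \in val (val (curve_act g r)).
  by move=> ur; rewrite /= -[sign_change g u](lfunE (sign_change g)) memv_img.
have n0 (u : 'rV[k]_4) : u != 0 -> sign_change g u != 0.
  by apply: contra => /eqP h; rewrite -[u](sign_changeK g) h linear0.
have ex := secant_eqmx sx vp wq v0 w0.
have ey := secant_eqmx sy (img _ _ vp) (img _ _ wq) (n0 v v0) (n0 w w0).
have xy l : (l <= x + x')%MS -> (sign_change g l <= y + y')%MS.
  by rewrite ex ey; apply: secant_mx_sign.
have yx l : (l <= y + y')%MS -> (sign_change g l <= x + x')%MS.
  (* Writing [v] and [w] as images of their own images lets [secant_mx_sign] serve for the way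
     back. *)
  rewrite ex ey -[v in X in _ -> X](sign_changeK g) -[w in X in _ -> X](sign_changeK g).
  exact: secant_mx_sign.
by split; [apply: xy | apply: xy | apply: yx | apply: yx];
  rewrite ?addsmxSl ?addsmxSr.
Qed.

End Secants.

(** * Line modules and the conclusion *)

Lemma twist_line_module (k : closedFieldType) (a b c : k) (g : Gamma)
    (p q : curve a c) (x x' y y' : 'rV[k]_4) :
  is_secant p q x x' -> is_secant (curve_act g p) (curve_act g q) y y' ->
  graded_iso (twist g (line_module a b c x x')) (line_module a b c y y').
Proof.
by move=> sx sy; have [] := secant_sign_change sx sy; apply: twist_line_module_eq.
Qed.

Theorem proposition7p7 (k : closedFieldType) (alpha beta gamma : k)
  (char_k : 2%N \notin [pchar k])
  (abc : alpha + beta + gamma + alpha * beta * gamma = 0)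
  (abc_notin : forall t : k,
     t \in [:: alpha; beta; gamma] -> t \notin [:: 0; 1; -1])
  (G : algebraic_group_law alpha gamma)
  (xi : 'I_3 -> curve alpha gamma)
  (xi_2torsion : forall i, E_add G (xi i) (xi i) = E_zero G)
  (gam_translation : forall (i : 'I_3) (p : curve alpha gamma),
     curve_act (gam i) p = E_add G p (xi i))
  (p q : curve alpha gamma) (i : 'I_3) :
  graded_iso (twist (gam i) (point_module alpha beta gamma (val p)))
             (point_module alpha beta gamma (val (E_add G p (xi i))))
  /\
  forall x x' y y' : 'rV[k]_4,
    is_secant p q x x' ->
    is_secant (E_add G p (xi i)) (E_add G q (xi i)) y y' ->
    graded_iso (twist (gam i) (line_module alpha beta gamma x x'))
               (line_module alpha beta gamma y y').
Proof.
(* Translations become [curve_act (gam i)], whose underlying point is [P3_act (gam i) (val p)] by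
   conversion. *)
rewrite -!gam_translation; split; first exact: twist_point_module.
by move=> x x' y y'; apply: twist_line_module.
Qed.
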